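(* Let $p$ be a prime, let $A$ be a commutative $\mathbb{F}_p$-algebra and let $n\geq 1$ be an integer. Then $$\mathsf{H}_i(A,\Phi^n(A))=0 \quad\text{for all } i>0,$$ and $$\mathsf{H}_0(A,\Phi^n(A))\cong \psi^n(A).$$
   Context: All algebras are associative (with unit) and all unadorned tensor products are over $\mathbb{F}_p$. For an $\mathbb{F}_p$-algebra $R$ and an $R$-$R$-bimodule $B$, $\mathsf{H}_\bullet(R,B)=\mathrm{Tor}^{R\otimes R^{op}}_\bullet(R,B)$ denotes Hochschild homology over $\mathbb{F}_p$; it is the homology of the standard simplicial vector space $C_n(R,B)=B\otimes R^{\otimes n}$ with faces $\partial_0(b,r_1,\dots,r_n)=(br_1,r_2,\dots,r_n)$, $\partial_i(b,r_1,\dots,r_n)=(b,\dots,r_ir_{i+1},\dots,r_n)$ for $0<i<n$, and $\partial_n(b,r_1,\dots,r_n)=(r_nb,r_1,\dots,r_{n-1})$. For an $A$-module $M$, $\Phi^n(M)$ is the $A$-$A$-bimodule which is $M$ as a left $A$-module and whose right $A$-module structure is $m\cdot a=a^{p^n}m$ for $a\in A$, $m\in M$. $\psi^n(A)$ is the quotient ring $A/(a-a^{p^n})$ of $A$ by the ideal generated by all elements $a-a^{p^n}$, $a\in A$, regarded as an $A$-module via the quotient map. *)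

(* Defs.v *)
From HB Require Import structures.
From mathcomp Require Import all_boot all_algebra.
From mathcomp Require Import boolp finmap monalg zify.

Set Implicit Arguments.
Unset Strict Implicit.
Unset Printing Implicit Defensive.

Import GRing.Theory.
Local Open Scope ring_scope.
Local Open Scope quotient_scope.

Section QuotientModule.
Variables (k : pzRingType) (V : lmodType k).

Inductive span (S : V -> Prop) : V -> Prop :=
| span_zero : span S 0
| span_lin c u v : S u -> span S v -> span S (c *: u + v).

Definition spanb (S : V -> Prop) : {pred V} := fun x => `[< span S x >].

Variable S : V -> Prop.

Lemma spanbP x : reflect (span S x) (x \in spanb S).
Proof. exact: asboolP. Qed.

Lemma span_gen u : S u -> span S u.
Proof.
by move=> Su; rewrite -[u]addr0 -[u]scale1r; apply: span_lin => //;
   apply: span_zero.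
Qed.

Lemma spanD u v : span S u -> span S v -> span S (u + v).
Proof.
elim=> [|c a b Sa _ IH] Sv; first by rewrite add0r.
by rewrite -addrA; apply: span_lin => //; apply: IH.
Qed.

Lemma spanZ c u : span S u -> span S (c *: u).
Proof.
elim=> [|d a b Sa _ IH]; first by rewrite scaler0; apply: span_zero.
by rewrite scalerDr scalerA; apply: span_lin.
Qed.

Lemma spanb_zmod_closed : zmod_closed (spanb S).
Proof.
split=> [|u v /spanbP Su /spanbP Sv]; apply/spanbP; first exact: span_zero.
by apply: spanD => //; rewrite -scaleN1r; apply: spanZ.
Qed.

HB.instance Definition _ := GRing.isZmodClosed.Build V (spanb S)
  spanb_zmod_closed.

(* V modulo the submodule generated by S. *)
Definition modq : Type := Quotient.quot (spanb S).
HB.instance Definition _ := GRing.Zmodule.on modq.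

Definition modq_pi (x : V) : modq := \pi_(Quotient.quot (spanb S)) x.
Definition modq_repr (x : modq) : V := repr (x : Quotient.quot (spanb S)).

Lemma modq_reprK : cancel modq_repr modq_pi.
Proof. by move=> x; rewrite /modq_pi reprK. Qed.

Lemma modq_pi_zmod : zmod_morphism modq_pi.
Proof. exact: (raddfB \pi_(Quotient.quot (spanb S))). Qed.

HB.instance Definition _ := GRing.isZmodMorphism.Build V modq modq_pi
  modq_pi_zmod.

Lemma modq_piP x y : modq_pi x = modq_pi y <-> span S (x - y).
Proof.
have E := Quotient.idealrBE (spanb S) x y.
split=> [h|/spanbP h]; first by apply/spanbP; rewrite E; apply/eqP.
by apply/eqP; rewrite -E.
Qed.

Definition modq_scale (c : k) (x : modq) : modq := modq_pi (c *: modq_repr x).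

Lemma modq_pi_scale c : {morph modq_pi : x / c *: x >-> modq_scale c x}.
Proof.
move=> x; apply/modq_piP; rewrite -scalerBr; apply: spanZ.
by apply/modq_piP; rewrite modq_reprK.
Qed.

Lemma modq_scaleA a b v : modq_scale a (modq_scale b v) = modq_scale (a * b) v.
Proof. by rewrite -[v]modq_reprK -!modq_pi_scale scalerA. Qed.

Lemma modq_scale1 : left_id 1 modq_scale.
Proof. by move=> v; rewrite -[v]modq_reprK -modq_pi_scale scale1r. Qed.

Lemma modq_scaleDr : right_distributive modq_scale +%R.
Proof.
move=> a u v; rewrite -[u]modq_reprK -[v]modq_reprK -raddfD -!modq_pi_scale.
by rewrite scalerDr raddfD.
Qed.

Lemma modq_scaleDl v : {morph modq_scale^~ v : a b / a + b}.
Proof.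
by move=> a b; rewrite -[v]modq_reprK -!modq_pi_scale scalerDl raddfD.
Qed.

HB.instance Definition _ := GRing.Zmodule_isLmodule.Build k modq
  modq_scaleA modq_scale1 modq_scaleDr modq_scaleDl.

HB.instance Definition _ := GRing.isScalable.Build k V modq *:%R modq_pi
  modq_pi_scale.

End QuotientModule.

Section QuotientRing.
Variables (A : comPzRingType) (S : A -> Prop).

(* A modulo the ideal generated by S. *)
Definition idealq : Type := modq (S : A^o -> Prop).
HB.instance Definition _ := GRing.Lmodule.on idealq.

Definition idealq_pi : A -> idealq := @modq_pi A A^o S.
HB.instance Definition _ := GRing.Linear.copy
  (idealq_pi : A^o -> idealq) (@modq_pi A A^o S).

Definition idealq_mul (x y : idealq) : idealq :=
  idealq_pi (modq_repr x * modq_repr y).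

Lemma idealq_reprK (x : idealq) : idealq_pi (modq_repr x) = x.
Proof. exact: modq_reprK. Qed.

Lemma idealq_pi_scale (a b : A) : idealq_pi (a * b) = a *: idealq_pi b.
Proof. exact: (@modq_pi_scale A A^o S). Qed.

Lemma idealq_piM : {morph idealq_pi : a b / a * b >-> idealq_mul a b}.
Proof.
move=> a b; rewrite /idealq_mul.
rewrite [RHS]idealq_pi_scale idealq_reprK -[RHS]idealq_pi_scale mulrC.
by rewrite [_ * b]mulrC [RHS]idealq_pi_scale idealq_reprK idealq_pi_scale.
Qed.

Lemma idealq_mulA : associative idealq_mul.
Proof.
move=> x y z; rewrite -[x]idealq_reprK -[y]idealq_reprK -[z]idealq_reprK.
by rewrite -!idealq_piM mulrA.
Qed.

Lemma idealq_mulC : commutative idealq_mul.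
Proof. by move=> x y; rewrite /idealq_mul mulrC. Qed.

Lemma idealq_mul1 : left_id (idealq_pi 1) idealq_mul.
Proof. by move=> x; rewrite -[x]idealq_reprK -idealq_piM mul1r. Qed.

Lemma idealq_mulDl : left_distributive idealq_mul +%R.
Proof.
move=> x y z; rewrite -[x]idealq_reprK -[y]idealq_reprK -[z]idealq_reprK.
by rewrite -raddfD -!idealq_piM mulrDl raddfD.
Qed.

HB.instance Definition _ := GRing.Zmodule_isComPzRing.Build idealq
  idealq_mulA idealq_mulC idealq_mul1 idealq_mulDl.

Lemma idealq_pi_monoid : monoid_morphism idealq_pi.
Proof. by split=> // a b; rewrite idealq_piM. Qed.

HB.instance Definition _ := GRing.isMonoidMorphism.Build A idealq idealq_pi
  idealq_pi_monoid.

Lemma idealq_scaleE a (x : idealq) : a *: x = idealq_pi a * x.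
Proof.
by rewrite -[x]idealq_reprK -idealq_pi_scale rmorphM.
Qed.

End QuotientRing.

(* The library's algType k excludes the zero ring, so a unital associative
   k-algebra is given by its structure morphism, central in the ring. *)
Record kalgebra (k : fieldType) := KAlgebra {
  kalg_sort :> pzRingType;
  kalg_in : {rmorphism k -> kalg_sort};
  kalg_central : forall c x, kalg_in c * x = x * kalg_in c
}.

Definition com_kalgebra (k : fieldType) (A : comPzRingType)
    (iota : {rmorphism k -> A}) : kalgebra k :=
  @KAlgebra k A iota (fun c x => mulrC (iota c) x).

Record bimodule (k : fieldType) (R : kalgebra k) := Bimodule {
  bimod_sort :> lmodType R;
  ract : bimod_sort -> R -> bimod_sort;
  ractDl : forall r, {morph ract^~ r : b b' / b + b'};
  ractDr : forall b, {morph ract b : r r' / r + r'};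
  ract1 : forall b, ract b 1 = b;
  ractM : forall b r r', ract b (r * r') = ract (ract b r) r';
  ractA : forall r b r', ract (r *: b) r' = r *: ract b r';
  ractk : forall c b, ract b (kalg_in R c) = kalg_in R c *: b
}.

Section MultilinearMaps.
Variables (k : fieldType) (R : kalgebra k) (B : bimodule R).

Definition gen n : Type := (B * {ffun 'I_n -> R})%type.
HB.instance Definition _ n := Choice.on (gen n).

Definition upd n (r : {ffun 'I_n -> R}) (j : 'I_n) (x : R) :
  {ffun 'I_n -> R} := [ffun i => if i == j then x else r i].

Definition multilinear n (W : lmodType k) (f : gen n -> W) : Prop :=
  (forall c b b' r,
     f (kalg_in R c *: b + b', r) = c *: f (b, r) + f (b', r)) /\
  (forall b r j c x y, f (b, upd r j (kalg_in R c * x + y)) =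
     c *: f (b, upd r j x) + f (b, upd r j y)).

Record multimap n (W : lmodType k) := Multimap {
  mfun :> gen n -> W;
  mfunP : multilinear mfun
}.

Inductive tensor_rel n : {malg k[gen n]} -> Prop :=
| tensor_rel0 c b b' r : tensor_rel
    (<<(kalg_in R c *: b + b', r) : gen n>> -
       (c *: <<(b, r) : gen n>> + <<(b', r) : gen n>>))
| tensor_relS b r j c x y : tensor_rel
    (<<(b, upd r j (kalg_in R c * x + y)) : gen n>> -
       (c *: <<(b, upd r j x) : gen n>> + <<(b, upd r j y) : gen n>>)).

(* B (x) R (x) ... (x) R over k, with n factors R: the free k-module on gen n
   modulo the multilinearity relations. *)
Definition hoch n : Type := modq (@tensor_rel n).
HB.instance Definition _ n := GRing.Lmodule.on (hoch n).

Definition pure n (t : gen n) : hoch n := modq_pi (@tensor_rel n) <<t>>.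

Lemma pure_multilinear n : multilinear (@pure n : gen n -> hoch n).
Proof.
split=> *; rewrite /pure -linearZ -raddfD; apply/modq_piP; apply: span_gen.
  exact: tensor_rel0.
exact: tensor_relS.
Qed.

Section Lift.
Variables (n : nat) (W : lmodType k) (f : multimap n W).

Definition mextend (g : {malg k[gen n]}) : W :=
  \sum_(t <- msupp g) g@_t *: f t.

Lemma mextendEw (g : {malg k[gen n]}) (D : {fset gen n}) :
  (msupp g `<=` D)%fset -> mextend g = \sum_(t <- D) g@_t *: f t.
Proof.
move=> sgD; rewrite /mextend (big_fset_incl _ sgD) // => t _ tg.
by rewrite mcoeff_outdom // scale0r.
Qed.

Lemma mextend_linear : linear mextend.
Proof.
move=> c g h; pose D := (msupp g `|` msupp h)%fset.
have sg : (msupp g `<=` D)%fset by apply: fsubsetUl.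
have sh : (msupp h `<=` D)%fset by apply: fsubsetUr.
have sgh : (msupp (c *: g + h) `<=` D)%fset.
  apply: (fsubset_trans (msuppD_le _ _)).
  by apply: fsetUSS => //; apply: msuppZ_le.
rewrite (mextendEw sg) (mextendEw sh) (mextendEw sgh) scaler_sumr -big_split.
by apply: eq_bigr => t _; rewrite mcoeffD mcoeffZ scalerDl scalerA.
Qed.

HB.instance Definition _ := GRing.isLinear.Build k {malg k[gen n]} W *:%R
  mextend mextend_linear.

Lemma mextendU t : mextend <<t>> = f t.
Proof.
rewrite /mextend msuppU oner_eq0 big_seq_fset1 mcoeffUU scale1r //.
Qed.

Lemma mextend_span g : span (@tensor_rel n) g -> mextend g = 0.
Proof.
elim=> [|c u v Ru _ IH]; first exact: raddf0.
rewrite mextend_linear IH addr0; case: Ru => *.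
  by rewrite raddfB /= mextend_linear !mextendU (mfunP f).1 subrr scaler0.
by rewrite raddfB /= mextend_linear !mextendU (mfunP f).2 subrr scaler0.
Qed.

Definition tlift (x : hoch n) : W := mextend (modq_repr x).

Lemma tlift_pi g : tlift (modq_pi (@tensor_rel n) g) = mextend g.
Proof.
apply/eqP; rewrite -subr_eq0 -raddfB; apply/eqP/mextend_span/modq_piP.
exact: modq_reprK.
Qed.

Lemma tlift_linear : linear tlift.
Proof.
move=> c x y; rewrite -[x]modq_reprK -[y]modq_reprK -linearP !tlift_pi.
exact: mextend_linear.
Qed.

HB.instance Definition _ := GRing.isLinear.Build k (hoch n) W *:%R
  tlift tlift_linear.

Lemma tlift_pure t : tlift (pure t) = f t.
Proof. by rewrite /pure tlift_pi mextendU. Qed.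

End Lift.

Lemma hoch_ext n (W : lmodType k) (f g : {linear hoch n -> W}) :
  (forall t, f (pure t) = g (pure t)) -> f =1 g.
Proof.
move=> fg x; rewrite -[x]modq_reprK [modq_repr x]monalgE !raddf_sum.
apply: eq_bigr => t _.
have -> : << (modq_repr x)@_t *g t >> = (modq_repr x)@_t *: <<t>>.
  by apply/malgP => u; rewrite mcoeffZ !mcoeffU mulrnAr mulr1.
have E := @modq_pi_scale _ _ (@tensor_rel n) (modq_repr x)@_t <<t>>.
by rewrite /= E [LHS]linearZ [RHS]linearZ -/(pure t) fg.
Qed.

End MultilinearMaps.

Section HochschildHomology.
Variables (k : fieldType) (R : kalgebra k) (B : bimodule R).

(* (r_1, ..., r_(n+1)) with r_i and r_(i+1) multiplied if 0 < i < n+1, without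
   r_1 if i = 0 and without r_(n+1) if i = n+1.  Ordinals being 0-based, r_(j+1)
   is r j. *)
Definition merge n (i : nat) (r : {ffun 'I_n.+1 -> R}) : {ffun 'I_n -> R} :=
  [ffun j : 'I_n =>
     if (j.+1 < i)%N then r (widen_ord (leqnSn n) j)
     else if j.+1 == i then r (widen_ord (leqnSn n) j) * r (lift ord0 j)
     else r (lift ord0 j)].

Definition face n (i : nat) (t : gen B n.+1) : gen B n :=
  (if i == 0%N then ract t.1 (t.2 ord0)
   else if i == n.+1 then t.2 ord_max *: t.1
   else t.1,
   merge i t.2).

Lemma merge_upd n (i : 'I_n.+2) (r : {ffun 'I_n.+1 -> R}) (j : 'I_n.+1) :
  ~~ ((i == 0%N :> nat) && (j == 0%N :> nat)) ->
  ~~ ((i == n.+1 :> nat) && (j == n :> nat)) ->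
  exists (j' : 'I_n) (u v : R),
    forall x, merge i (upd r j x) = upd (merge i r) j' (u * x * v).
Proof.
move=> h0 h1; have [lti ltj] := (ltn_ord i, ltn_ord j).
have [ji|ij] := ltnP j i.
  have ltjn : (j < n)%N by lia.
  exists (Ordinal ltjn), 1, (if j.+1 == i then r (lift ord0 (Ordinal ltjn)) else 1).
  move=> x; apply/ffunP=> l; rewrite !ffunE -!val_eqE /= /bump /= add1n mul1r.
  case: (eqVneq (l : nat) j) => [lj|lj].
    have -> : l = Ordinal ltjn by apply: val_inj.
    rewrite /=; have -> : (j.+1 == j :> nat) = false by lia.
    have [a|a|a] := ltngtP j.+1 i; rewrite ?mulr1 //; lia.
  have [a|a|a] := ltngtP l.+1 i => //.
    by have -> : (l.+1 == j :> nat) = false by lia.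
  by have -> : (l.+1 == j :> nat) = false by lia.
have ltjn : (j.-1 < n)%N by lia.
exists (Ordinal ltjn),
  (if j == i :> nat then r (widen_ord (leqnSn n) (Ordinal ltjn)) else 1), 1.
move=> x; apply/ffunP=> l; rewrite !ffunE -!val_eqE /= /bump /= add1n mulr1.
have -> : (l.+1 == j :> nat) = (l == j.-1 :> nat) by lia.
case: (eqVneq (l : nat) j.-1) => [lj|lj].
  have El : l = Ordinal ltjn by apply: val_inj.
  have -> : (l == j :> nat) = false by lia.
  have [a|a|a] := ltngtP l.+1 i; first lia.
    have -> : (j == i :> nat) = false by lia.
    by rewrite mul1r.
  have -> : (j == i :> nat) = true by lia.
  by rewrite El.
have [a|a|a] := ltngtP l.+1 i => //.
  by have -> : (l == j :> nat) = false by lia.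
by have -> : (l == j :> nat) = false by lia.
Qed.

Lemma face_multilinear n (i : 'I_n.+2) :
  multilinear (fun t : gen B n.+1 => pure (face i t)).
Proof.
have P := @pure_multilinear k R B n.
split=> [c b b' r|b r j c x y]; rewrite /face /=.
  case: ifP => _; first by rewrite ractDl ractA P.1.
  case: ifP => _; last exact: P.1.
  by rewrite scalerDr scalerA -kalg_central -scalerA P.1.
have [/andP[/eqP i0 /eqP j0]|h0] :=
    boolP ((i == 0%N :> nat) && (j == 0%N :> nat)).
  have E z : merge i (upd r j z) = merge i r.
    by apply/ffunP=> l; rewrite !ffunE -!val_eqE /= i0 j0.
  have {}j0 : j = ord0 by apply: val_inj.
  rewrite !E i0 /= !ffunE j0 eqxx ractDr ractM ractk ractA.
  exact: P.1.
have [/andP[/eqP i1 /eqP j1]|h1] :=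
    boolP ((i == n.+1 :> nat) && (j == n :> nat)).
  have E z : merge i (upd r j z) = merge i r.
    apply/ffunP=> l; have ltl := ltn_ord l.
    rewrite !ffunE -!val_eqE /= i1 j1 ltnS ltl.
    by have -> : (l == n :> nat) = false by lia.
  have {}j1 : j = ord_max by apply: val_inj.
  rewrite !E i1 /= eqxx !ffunE j1 eqxx scalerDl -scalerA.
  exact: P.1.
have [j' [u [v E]]] := merge_upd r h0 h1.
have E0 z : i == 0%N :> nat -> upd r j z ord0 = r ord0.
  move=> i0; rewrite ffunE -val_eqE /=; move: h0; rewrite i0 /= eq_sym.
  by move/negbTE->.
have E1 z : i == n.+1 :> nat -> upd r j z ord_max = r ord_max.
  move=> i1; rewrite ffunE -val_eqE /=; move: h1; rewrite i1 /= eq_sym.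
  by move/negbTE->.
pose b0 := (face i (b, r)).1.
have Eb z : (if i == 0%N :> nat then ract b (upd r j z ord0)
    else if i == n.+1 :> nat then upd r j z ord_max *: b else b) = b0.
  rewrite /b0 /face /=; case: ifP => [i0|_]; first by rewrite E0.
  by case: ifP => // i1; rewrite E1.
rewrite !Eb !E -P.2; congr (pure (_, upd _ _ _)).
by rewrite mulrDr mulrDl !mulrA -kalg_central.
Qed.

Definition face_map n (i : 'I_n.+2) : multimap B n.+1 (hoch B n) :=
  Multimap (face_multilinear i).

Definition boundary n (x : hoch B n.+1) : hoch B n :=
  \sum_(i < n.+2) (-1) ^+ i *: tlift (face_map i) x.

Lemma boundary_linear n : linear (@boundary n).
Proof.
move=> c x y; rewrite /boundary scaler_sumr -big_split; apply: eq_bigr => i _.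
by rewrite linearP scalerDr !scalerA mulrC.
Qed.

HB.instance Definition _ n := GRing.isLinear.Build k (hoch B n.+1) (hoch B n)
  *:%R (@boundary n) (@boundary_linear n).

Lemma boundary_pure n (t : gen B n.+1) :
  boundary (pure t) = \sum_(i < n.+2) (-1) ^+ i *: pure (face i t).
Proof. by apply: eq_bigr => i _; rewrite tlift_pure. Qed.

Lemma merge_merge n (i j : nat) (r : {ffun 'I_n.+2 -> R}) :
  (i < j <= n.+2)%N -> merge i (merge j r) = merge j.-1 (merge i r).
Proof.
move=> /andP[ltij lej]; apply/ffunP=> l; have ltl := ltn_ord l.
have eqr (x y : 'I_n.+2) : x = y :> nat -> r x = r y.
  by move=> xy; congr (r _); apply: val_inj.
rewrite !ffunE /= /bump /= !add1n.
by have [a|a|a] := ltngtP l.+1 i; have [c|c|c] := ltngtP l.+1 j;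
   try (exfalso; lia);
   have [d|d|d] := ltngtP l.+1 j.-1; try (exfalso; lia);
   have [e|e|e] := ltngtP l.+2 j; try (exfalso; lia);
   have [f|f|f] := ltngtP l.+2 i; try (exfalso; lia); rewrite ?mulrA;
   repeat (congr (_ * _)); apply: eqr.
Qed.

Lemma face_face n (i j : nat) (t : gen B n.+2) : (i < j <= n.+2)%N ->
  face i (face j t) = face j.-1 (face i t).
Proof.
move=> /[dup] ltij /andP[lij lej]; case: t => b r.
rewrite /face /= merge_merge //; congr (_, _).
have eqr (x y : 'I_n.+2) : x = y :> nat -> r x = r y.
  by move=> xy; congr (r _); apply: val_inj.
rewrite !ffunE /= /bump /=.
rewrite (eqr (widen_ord _ ord0) ord0) // (eqr (lift ord0 ord_max) ord_max) //.
have -> : (i == n.+2) = false by lia.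
have -> : (j == 0%N) = false by lia.
have [i0|i0] := eqVneq i 0%N.
  rewrite i0 /=.
  have [j1|j1] := eqVneq j 1%N; first by rewrite j1 /= ractM.
  have -> : (1 < j)%N by lia.
  have -> : (j.-1 == 0%N) = false by lia.
  have -> : (j.-1 == n.+1) = (j == n.+2) by lia.
  by case: ifP => // _; rewrite ractA.
have -> : (j.-1 == 0%N) = false by lia.
have -> : (j.-1 == n.+1) = (j == n.+2) by lia.
have -> : (n.+1 < i)%N = false by lia.
rewrite [n.+1 == i]eq_sym.
have [i1|i1] := eqVneq i n.+1; last by [].
have jn : j = n.+2 by lia.
by rewrite jn eqxx ltnSn scalerA.
Qed.

Lemma boundary_boundary n (x : hoch B n.+2) : boundary (boundary x) = 0.
Proof.
pose f : {linear hoch B n.+2 -> hoch B n} := @boundary n \o @boundary n.+1.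
pose g : {linear hoch B n.+2 -> hoch B n} := \0.
apply: (hoch_ext (f := f) (g := g)) => t; rewrite /f /g /= {f g x}.
rewrite boundary_pure raddf_sum.
pose F (i j : nat) : hoch B n := (-1) ^+ (i + j) *: pure (face i (face j t)).
have -> : \sum_(j < n.+3) boundary ((-1) ^+ j *: pure (face j t)) =
    \sum_(j < n.+3) \sum_(i < n.+2) F i j.
  apply: eq_bigr => j _; rewrite linearZ /= boundary_pure scaler_sumr.
  by apply: eq_bigr => i _; rewrite scalerA -exprD addnC.
rewrite pair_big /= (bigID (fun u : 'I_n.+3 * 'I_n.+2 => (u.2 < u.1)%N)) /=.
rewrite [X in _ + X](reindex_onto
  (fun u : 'I_n.+3 * 'I_n.+2 => (widen_ord (leqnSn n.+2) u.2, inord u.1.-1))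
  (fun u : 'I_n.+3 * 'I_n.+2 => (lift ord0 u.2, inord u.1))) /=; last first.
  move=> [j i] /=; rewrite -leqNgt => ji; have ltj := ltn_ord j.
  have lti := ltn_ord i.
  by congr (_, _); apply: val_inj; rewrite /= ?inordK //= ?/bump /=; lia.
rewrite [X in _ + X](eq_bigl (fun u : 'I_n.+3 * 'I_n.+2 => (u.2 < u.1)%N));
    last first.
  move=> [j i] /=; rewrite xpair_eqE -!val_eqE /= /bump /=.
  have ltj := ltn_ord j; have lti := ltn_ord i.
  rewrite !inordK; [|lia|lia]; lia.
rewrite -big_split big1 //= => -[j i] /= ij; have ltj := ltn_ord j.
rewrite /F inordK; last lia.
rewrite (@face_face n i j t); last by rewrite ij /=; lia.
rewrite -scalerDl; have -> : (i + j = (j.-1 + i).+1)%N by lia.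
by rewrite exprS mulN1r addNr scale0r.
Qed.

(* The differential C_n -> C_(n-1), zero for n = 0. *)
Definition hoch_diff n : hoch B n -> hoch B n.-1 :=
  match n with 0%N => fun=> 0 | m.+1 => @boundary m end.

Lemma hoch_diff_linear n : linear (@hoch_diff n).
Proof.
by case: n => [|n] c x y /=; [rewrite scaler0 addr0 | apply: boundary_linear].
Qed.

HB.instance Definition _ n := GRing.isLinear.Build k (hoch B n) (hoch B n.-1)
  *:%R (@hoch_diff n) (@hoch_diff_linear n).

Definition cycleb n : {pred hoch B n} := fun x => hoch_diff x == 0.

Lemma cycleb_submod n : submod_closed (@cycleb n).
Proof.
split=> [|c x y /eqP x0 /eqP y0]; apply/eqP; first exact: raddf0.
by rewrite hoch_diff_linear x0 y0 scaler0 addr0.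
Qed.

HB.instance Definition _ n := GRing.isSubmodClosed.Build k (hoch B n)
  (@cycleb n) (@cycleb_submod n).

Definition cycle n : Type := {x : hoch B n | x \in @cycleb n}.
HB.instance Definition _ n := SubChoice.on (cycle n).
HB.instance Definition _ n :=
  [SubChoice_isSubLmodule of cycle n by <:].

Definition is_boundary n (z : cycle n) : Prop := exists y, val z = boundary y.

(* The boundaries already form a submodule of the cycles. *)
Definition HH n : Type := modq (@is_boundary n).
HB.instance Definition _ n := GRing.Lmodule.on (HH n).

End HochschildHomology.

Section CommutativeAction.
Variables (k : fieldType) (A : comPzRingType) (iota : {rmorphism k -> A}).
Variable (B : bimodule (com_kalgebra iota)).

(* For commutative A, left multiplication on B is an endomorphism of the
   bimodule B; it acts on the Hochschild complex and its homology. *)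
Definition gen_act n (a : A) (t : gen B n) : gen B n := (a *: t.1, t.2).

Lemma gen_act_multilinear n a :
  multilinear (fun t : gen B n => pure (gen_act a t)).
Proof.
have P := @pure_multilinear k _ B n.
split=> [c b b' r|b r j c x y]; rewrite /gen_act /=; last exact: P.2.
rewrite -P.1; congr (pure (_, _)); rewrite scalerDr !scalerA /=.
by rewrite [a * _]mulrC.
Qed.

Definition hoch_act n (a : A) : hoch B n -> hoch B n :=
  tlift (Multimap (gen_act_multilinear n a)).
HB.instance Definition _ n a := GRing.Linear.on (@hoch_act n a).

Lemma hoch_act_pure n a (t : gen B n) :
  hoch_act a (pure t) = pure (gen_act a t).
Proof. exact: tlift_pure. Qed.

Lemma face_act n (i : nat) a (t : gen B n.+1) :
  face i (gen_act a t) = gen_act a (face i t).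
Proof.
rewrite /face /gen_act /=; congr (_, _).
case: ifP => _; first exact: ractA.
by case: ifP => // _; rewrite !scalerA [a * _]mulrC.
Qed.

Lemma boundary_act n a (x : hoch B n.+1) :
  boundary (hoch_act a x) = hoch_act a (boundary x).
Proof.
pose f : {linear hoch B n.+1 -> hoch B n} := @boundary _ _ B n \o @hoch_act _ a.
pose g : {linear hoch B n.+1 -> hoch B n} := @hoch_act n a \o @boundary _ _ B n.
apply: (hoch_ext (f := f) (g := g)) => t; rewrite /f /g /=.
rewrite hoch_act_pure !boundary_pure raddf_sum; apply: eq_bigr => i _.
by rewrite face_act [RHS]linearZ /= hoch_act_pure.
Qed.

Lemma hoch_diff_act n a (x : hoch B n) :
  hoch_diff (hoch_act a x) = hoch_act a (hoch_diff x).
Proof. by case: n x => [|n] x /=; [rewrite raddf0 | rewrite boundary_act]. Qed.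

Lemma cycle_act_subproof n a (z : cycle B n) :
  hoch_act a (val z) \in @cycleb _ _ B n.
Proof.
by apply/eqP; rewrite hoch_diff_act (eqP (valP z)) raddf0.
Qed.

Definition cycle_act n (a : A) (z : cycle B n) : cycle B n :=
  exist _ (hoch_act a (val z)) (cycle_act_subproof a z).

Definition HH_act n (a : A) (x : HH B n) : HH B n :=
  modq_pi (@is_boundary _ _ B n) (cycle_act a (modq_repr x)).

Lemma is_boundary_span n (z : cycle B n) :
  span (@is_boundary _ _ B n) z -> is_boundary z.
Proof.
elim=> [|c u v [y uy] _ [y' vy']]; first by exists 0; rewrite !raddf0.
by exists (c *: y + y'); rewrite boundary_linear -uy -vy'.
Qed.

Lemma HH_act_pi n a (z : cycle B n) :
  HH_act a (modq_pi _ z) = modq_pi _ (cycle_act a z).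
Proof.
apply/modq_piP; apply: span_gen.
set z' := modq_repr _.
have [y zy] : is_boundary (z' - z).
  by apply: is_boundary_span; apply/modq_piP; rewrite modq_reprK.
exists (hoch_act a y); rewrite boundary_act -zy.
by rewrite !raddfB.
Qed.

End CommutativeAction.

Section PhiPsi.
Variables (p : nat) (pr_p : prime p) (A : comPzRingType).
Variable iota : {rmorphism 'F_p -> A}.

(* The library's Frobenius lemmas assume 1 != 0. *)
Lemma exprDpX n (a b : A) :
  (a + b) ^+ (p ^ n) = a ^+ (p ^ n) + b ^+ (p ^ n).
Proof.
have p0 (x : A) : x *+ p = 0.
  by rewrite -mulr_natr -(rmorph_nat iota) pchar_Fp_0 // rmorph0 mulr0.
elim: n => [|n IH]; first by rewrite !expr1.
rewrite expnSr !exprM IH; move: (a ^+ _) (b ^+ _) => {IH a b} a b.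
move: (p) pr_p p0 => [//|q] pr_q q0.
rewrite exprDn big_ord_recl big_ord_recr /= big1 => [|i _].
  by rewrite add0r /bump /= add1n subn0 subnn bin0 binn mulr1 mul1r !mulr1n.
have /dvdnP[m ->] : (q.+1 %| 'C(q.+1, lift ord0 (widen_ord (leqnSn q) i)))%N.
  by apply: prime_dvd_bin => //; rewrite /= /bump /= add1n !ltnS ltn_ord.
by rewrite mulrnA q0.
Qed.

Lemma Fp_expX n (c : 'F_p) : c ^+ (p ^ n) = c.
Proof.
elim: n => [|n IH]; first by rewrite expr1.
rewrite expnSr exprM IH -[c]natr_Zp.
exact: (pFrobenius_aut_nat (pchar_Fp pr_p)).
Qed.

Section Phi.
Variables (n : nat) (M : lmodType A).

Definition Phi_ract (m : M) (a : A) : M := a ^+ (p ^ n) *: m.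

Lemma Phi_ractDl a : {morph Phi_ract^~ a : m m' / m + m'}.
Proof. by move=> m m'; apply: scalerDr. Qed.

Lemma Phi_ractDr m : {morph Phi_ract m : a b / a + b}.
Proof.
by move=> a b; rewrite /Phi_ract exprDpX scalerDl.
Qed.

Lemma Phi_ract1 m : Phi_ract m 1 = m.
Proof. by rewrite /Phi_ract expr1n scale1r. Qed.

Lemma Phi_ractM m a b : Phi_ract m (a * b) = Phi_ract (Phi_ract m a) b.
Proof. by rewrite /Phi_ract scalerA exprMn mulrC. Qed.

Lemma Phi_ractA a m b : Phi_ract (a *: m) b = a *: Phi_ract m b.
Proof. by rewrite /Phi_ract !scalerA mulrC. Qed.

Lemma Phi_ractk c m : Phi_ract m (iota c) = iota c *: m.
Proof. by rewrite /Phi_ract -rmorphXn Fp_expX. Qed.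

Definition Phi : bimodule (com_kalgebra iota) :=
  @Bimodule _ (com_kalgebra iota) M Phi_ract Phi_ractDl Phi_ractDr Phi_ract1
    Phi_ractM Phi_ractA Phi_ractk.

End Phi.
End PhiPsi.

(* As an idealq, this is a commutative ring and an A-module, with
   a *: x = idealq_pi a * x. *)
Definition psi (p : nat) (A : comPzRingType) (n : nat) : Type :=
  idealq (fun x : A => exists a : A, x = a - a ^+ (p ^ n)).
HB.instance Definition _ p A n := GRing.ComPzRing.on (psi p A n).
HB.instance Definition _ p A n := GRing.Lmodule.on (psi p A n).

(* Main.v *)
(* C_m = A^(m+1) is a simplicial commutative ring, because a |-> a^q, with
   q = p^n, is a ring endomorphism of A.  Two facts about its q-th power map:
   - It is homotopic to the identity.  With rot(b; r_1, ..., r_m) =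
     (r_1^q; r_2, ..., r_m, b), the q-th power map is rot^(m+1), and the extra
     degeneracy (b; r_1, ..., r_m) |-> (1; r_1, ..., r_m, b) makes rot homotopic
     to (-1)^m on the elements killed by all faces.
   - It kills homology in positive degree: if all faces kill x and y, then
     s_0 x * s_1 y has boundary - x * y, and q >= 2 makes x^q such a product.
   Every cycle is homologous to one killed by all faces, so H_m = 0 for m > 0.
   In degree 0, the boundary of (b; r) is (r^q - r) b. *)
Require Import Defs.
From mathcomp Require Import all_boot all_algebra.
From HB Require Import structures.
From mathcomp Require Import monalg zify.

Set Implicit Arguments.
Unset Strict Implicit.
Unset Printing Implicit Defensive.

Import GRing.Theory.
Local Open Scope ring_scope.

(** Induction over the support of a representative in the free module: a tensor is a finite linear
    combination of pure tensors. *)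
Lemma hoch_ind (k : fieldType) (R : kalgebra k) (B : bimodule R) m
    (P : hoch B m -> Prop) :
  P 0 -> (forall c t x, P x -> P (c *: pure t + x)) -> forall x, P x.
Proof.
move=> P0 PS x; rewrite -[x]modq_reprK [modq_repr x]monalgE raddf_sum.
elim: (X in \sum_(_ <- X) _) => [|t s IHs]; first by rewrite big_nil.
rewrite big_cons; set c := _@_t.
have -> : << c *g t >> = c *: (<<t>> : {malg k[gen B m]}).
  by apply/malgP => u; rewrite mcoeffZ !mcoeffU mulrnAr mulr1.
have E := @modq_pi_scale _ _ (@tensor_rel k R B m) c <<t>>.
by rewrite /= E; apply: PS.
Qed.

Section FrobeniusTwist.
Variables (p : nat) (pr_p : prime p) (A : comPzRingType).
Variables (iota : {rmorphism 'F_p -> A}) (e : nat).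

(** * Pure tensors written as words *)

Local Notation B := (Phi pr_p iota e A^o).
Local Notation q := (p ^ e)%N.

(* (b; r_1, ..., r_m) as the word r_1 ... r_m b: in this order every face
   operator of positive index multiplies two adjacent letters. *)
Definition mkgen m (w : nat -> A) : gen B m :=
  (w m, [ffun l : 'I_m => w l]).

(** [insub] fails at every position from [m] on, so all of these read the bimodule entry, not only
    position [m]. *)
Definition word m (t : gen B m) (l : nat) : A :=
  if insub l is Some l' then t.2 l' else t.1.

Lemma word_ord m (t : gen B m) (l : 'I_m) : word t l = t.2 l.
Proof. by rewrite /word valK. Qed.

Lemma word_last m (t : gen B m) : word t m = t.1.
Proof. by rewrite /word insubF // ltnn. Qed.

Lemma word_mkgen m w l : (l <= m)%N -> word (mkgen m w) l = w l.
Proof.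
rewrite leq_eqVlt => /predU1P[->|ltl]; first by rewrite word_last.
by rewrite (word_ord _ (Ordinal ltl)) ffunE.
Qed.

Lemma word_inj m (t u : gen B m) :
  (forall l, (l <= m)%N -> word t l = word u l) -> t = u.
Proof.
case: t u => [b r] [b' r'] tu.
have /= := tu m (leqnn m); rewrite !word_last /= => ->.
congr (_, _); apply/ffunP=> l.
by have /= := tu l (ltnW (ltn_ord l)); rewrite !word_ord.
Qed.

Lemma word_face0 m (t : gen B m.+1) l : (l <= m)%N ->
  word (face 0 t) l =
  if l == m then word t 0 ^+ q * word t m.+1 else word t l.+1.
Proof.
case: ltngtP => // [ltl|->] _.
  by rewrite (word_ord _ (Ordinal ltl)) ffunE /= -word_ord /= /bump /= add1n.
by rewrite !word_last /= (word_ord _ ord0).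
Qed.

Lemma word_face m (t : gen B m.+1) i l : (l <= m)%N -> (0 < i <= m.+1)%N ->
  word (face i t) l =
  if (l.+1 < i)%N then word t l
  else if l.+1 == i then word t l * word t l.+1 else word t l.+1.
Proof.
move=> + /andP[i0 im]; have i0F : (i == 0%N) = false by lia.
rewrite leq_eqVlt => /predU1P[->|ltl]; last first.
  by rewrite (word_ord _ (Ordinal ltl)) ffunE /= -!word_ord /= /bump /= add1n.
rewrite !word_last /face /= i0F; have -> : (m.+1 < i)%N = false by lia.
by rewrite eq_sym; case: ifP => // _; rewrite -word_ord.
Qed.

Definition subst_at m (t : gen B m) (l : nat) (x : A) : gen B m :=
  mkgen m (fun l' => if l' == l then x else word t l').

Lemma word_subst m (t : gen B m) l x l' : (l' <= m)%N ->
  word (subst_at t l x) l' = if l' == l then x else word t l'.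
Proof. exact: word_mkgen. Qed.

Lemma subst_at_last m (t : gen B m) x : subst_at t m x = (x, t.2).
Proof.
apply: word_inj => l; rewrite leq_eqVlt => /predU1P[->|ltl].
  by rewrite word_subst // eqxx word_last.
rewrite word_subst 1?ltnW // ifN; last lia.
by rewrite !(word_ord _ (Ordinal ltl)).
Qed.

Lemma subst_at_ord m (t : gen B m) (j : 'I_m) x :
  subst_at t j x = (t.1, upd t.2 j x).
Proof.
have ltj := ltn_ord j.
apply: word_inj => l; rewrite leq_eqVlt => /predU1P[->|ltl].
  by rewrite word_subst // !word_last ifN //; lia.
rewrite word_subst 1?ltnW // !(word_ord _ (Ordinal ltl)) ffunE.
by rewrite -val_eqE.
Qed.

(** Substitution at position [m] changes the bimodule entry, and below [m] an algebra entry; one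
    condition on words thus covers both clauses of [multilinear]. *)
Lemma multilinear_words m (W : lmodType 'F_p) (f : gen B m -> W) :
  (forall t l c x y, (l <= m)%N ->
     f (subst_at t l (iota c * x + y)) =
     c *: f (subst_at t l x) + f (subst_at t l y)) ->
  multilinear f.
Proof.
move=> fP; split=> [c b b' r|b r j c x y].
  have := fP (b, r) m c b b' (leqnn m).
  by rewrite !subst_at_last.
have := fP (b, r) j c x y (ltnW (ltn_ord j)).
by rewrite !subst_at_ord.
Qed.

(** * Product, degeneracies and rotation on words *)

Definition gmul m (t u : gen B m) : gen B m :=
  mkgen m (fun l => word t l * word u l).

Definition gone m : gen B m := mkgen m (fun=> 1).

(* The degeneracies are j = 0, ..., m; j = m.+1 is the extra degeneracy. *)
Definition gdeg m (j : nat) (t : gen B m) : gen B m.+1 :=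
  mkgen m.+1 (fun l =>
    if (l < j)%N then word t l else if l == j then 1 else word t l.-1).

Definition grot m (t : gen B m) : gen B m :=
  mkgen m (fun l => if l == m then word t 0 ^+ q else word t l.+1).

Lemma gmul_subst m (t u : gen B m) l x : (l <= m)%N ->
  gmul (subst_at t l x) u = subst_at (gmul t u) l (x * word u l).
Proof.
move=> lm; apply: word_inj => l' l'm; rewrite !word_mkgen //.
by case: eqP => // ->.
Qed.

Lemma gmulC m (t u : gen B m) : gmul t u = gmul u t.
Proof. by apply: word_inj => l lm; rewrite !word_mkgen // mulrC. Qed.

Lemma gmulA m (t u v : gen B m) : gmul t (gmul u v) = gmul (gmul t u) v.
Proof. by apply: word_inj => l lm; rewrite !word_mkgen // mulrA. Qed.

Lemma gmul1 m (t : gen B m) : gmul (gone m) t = t.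
Proof. by apply: word_inj => l lm; rewrite !word_mkgen // mul1r. Qed.

Lemma gdeg_subst m j (t : gen B m) l x : (j <= m.+1)%N -> (l <= m)%N ->
  gdeg j (subst_at t l x) =
  subst_at (gdeg j t) (if (l < j)%N then l else l.+1) x.
Proof.
move=> jm lm; apply: word_inj => l' l'm.
rewrite (word_subst _ _ _ l'm) !(word_mkgen _ l'm).
have [lj|lj|lj] := ltngtP l' j.
- rewrite word_subst; last lia.
  have -> // : (l' == (if l < j then l else l.+1)%N) = (l' == l).
  by case: ifP; lia.
- rewrite word_subst; last lia.
  have -> // : (l' == (if l < j then l else l.+1)%N) = (l'.-1 == l).
  by case: ifP; lia.
by have -> : (l' == (if l < j then l else l.+1)%N) = false by case: ifP; lia.
Qed.

Lemma grot_subst m (t : gen B m) l x : (l <= m)%N ->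
  grot (subst_at t l x) =
  subst_at (grot t) (if l == 0%N then m else l.-1)
    (if l == 0%N then x ^+ q else x).
Proof.
move=> lm; apply: word_inj => l' l'm.
rewrite (word_subst _ _ _ l'm) !(word_mkgen _ l'm).
have [l'E|lm'] := eqVneq l' m.
  rewrite word_subst // eq_sym; have [l0|l0] := eqVneq l 0%N.
    by rewrite l'E eqxx.
  by have -> : (l' == l.-1) = false by lia.
rewrite word_subst; last lia.
have [->|l0] := eqVneq l 0%N; first by rewrite (negbTE lm').
by have -> : (l'.+1 == l) = (l' == l.-1) by lia.
Qed.

(** Each rotation moves the first letter to the end and raises it to the power [q]. The quotient by
    [m.+1] counts how often a letter has wrapped around. *)
Lemma iter_grot m (t : gen B m) k :
  iter k (@grot m) t =
  mkgen m (fun l => word t ((l + k) %% m.+1) ^+ (q ^ ((l + k) %/ m.+1))).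
Proof.
elim: k => [|k IHk].
  apply: word_inj => l lm; rewrite word_mkgen // addn0.
  by rewrite modn_small // divn_small.
rewrite iterS IHk; apply: word_inj => l lm; rewrite !(word_mkgen _ lm).
case: (eqVneq l m) => [->|l'm]; last by rewrite word_mkgen ?addSnnS //; lia.
rewrite word_mkgen // add0n addnS -addSn modnDl divnDl // divnn /=.
by rewrite -exprM -expnSr.
Qed.

Lemma iter_grot_full m (t : gen B m) :
  iter m.+1 (@grot m) t = mkgen m (fun l => word t l ^+ q).
Proof.
rewrite iter_grot; apply: word_inj => l lm; rewrite !word_mkgen //.
by rewrite modnDr divnDr // divnn modn_small // divn_small.
Qed.

(** * Simplicial identities on words *)

Lemma face_gmul m i (t u : gen B m.+1) : (i <= m.+1)%N ->
  face i (gmul t u) = gmul (face i t) (face i u).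
Proof.
move=> im; apply: word_inj => l lm; rewrite word_mkgen //.
have [i0|i0] := posnP i.
  have l1 : (l <= m.+1)%N by lia.
  rewrite i0 !word_face0 // !word_mkgen //.
  by case: ifP => // _; rewrite exprMn mulrACA.
have l1 : (l <= m.+1)%N by lia.
rewrite !word_face ?i0 // !word_mkgen //.
by do 2![case: ifP => // _]; rewrite mulrACA.
Qed.

(** Unfolds all letters, splits every index comparison and lets [lia] refute the impossible cases;
    what remains equates single letters or products of two. *)
Ltac word_cases :=
  repeat (match goal with
  | |- context [word (mkgen ?m ?w) ?l] =>
      rewrite (@word_mkgen m w l); [|lia]
  | |- context [word (face 0 ?t) ?l] => rewrite (@word_face0 _ t l); [|lia]
  | |- context [word (face ?i ?t) ?l] =>
      rewrite (@word_face _ t i l); [|lia|lia]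
  | |- context [if ?b then _ else _] => case: (boolP b) => ?
  end; try (exfalso; lia));
  rewrite ?exprMn ?mulr1 ?expr1n ?mul1r;
  first [ by [] | by congr word; lia | by congr (word _ _ * word _ _); lia
        | by rewrite mulrC; congr (_ * _); try congr (_ ^+ _); congr word;
             lia ].

(** The second condition excludes face 0 of the extra degeneracy [j = m.+2], which is a rotation by
    [face0_gdeg_last]. *)
Lemma face_gdeg_lt m i j (t : gen B m.+1) :
  (i < j <= m.+2)%N -> (0 < i)%N || (j <= m.+1)%N ->
  face i (gdeg j t) = gdeg j.-1 (face i t).
Proof.
move=> /andP[ij jm] ijm; apply: word_inj => l lm; rewrite /gdeg.
have [i0|i0] := posnP i; [subst i|]; word_cases.
Qed.

Lemma face_gdeg_eq m j (t : gen B m) : (j <= m.+1)%N ->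
  face j (gdeg j t) = t.
Proof.
move=> jm; apply: word_inj => l lm; rewrite /gdeg.
have [j0|j0] := posnP j; [subst j|]; word_cases.
Qed.

Lemma face_gdeg_eqS m j (t : gen B m) : (j <= m)%N ->
  face j.+1 (gdeg j t) = t.
Proof.
by move=> jm; apply: word_inj => l lm; rewrite /gdeg; word_cases.
Qed.

Lemma face_gdeg_gt m i j (t : gen B m.+1) : (j.+1 < i <= m.+2)%N ->
  face i (gdeg j t) = gdeg j (face i.-1 t).
Proof.
move=> /andP[ij im]; apply: word_inj => l lm; rewrite /gdeg.
word_cases.
Qed.

Lemma face0_gdeg_last m (t : gen B m) : face 0 (gdeg m.+1 t) = grot t.
Proof.
by apply: word_inj => l lm; rewrite /gdeg /grot; word_cases.
Qed.

Lemma face_grot m i (t : gen B m.+1) : (i <= m)%N ->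
  face i (grot t) = grot (face i.+1 t).
Proof.
move=> im; apply: word_inj => l lm; rewrite /grot.
have [i0|i0] := posnP i; [subst i|]; word_cases.
Qed.

Lemma face_grot_last m (t : gen B m.+1) : face m.+1 (grot t) = face 0 t.
Proof.
by apply: word_inj => l lm; rewrite /grot; word_cases.
Qed.

(* Only the universal property of the tensor powers is used here.  Keeping them
   abstract prevents the unifier from unfolding their construction. *)
Section TensorPowers.
Variables (V : nat -> lmodType 'F_p) (tens : forall m, gen B m -> V m).
Hypothesis tensP : forall m, multilinear (@tens m).
Hypothesis tens_ind : forall m (P : V m -> Prop),
  P 0 -> (forall c t x, P x -> P (c *: tens t + x)) -> forall x, P x.
Variable lift : forall m m' (f : gen B m -> V m'),
  multilinear f -> {linear V m -> V m'}.
Hypothesis lift_tens : forall m m' (f : gen B m -> V m') (fP : multilinear f) t,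
  lift fP (tens t) = f t.
Variable D : forall m, nat -> {linear V m.+1 -> V m}.
Hypothesis D_tens : forall m i (t : gen B m.+1), (i <= m.+1)%N ->
  D m i (tens t) = tens (face i t).

(** * The commutative ring structure on tensor powers and its Frobenius *)

Lemma tens_subst m (t : gen B m) l c x y : (l <= m)%N ->
  tens (subst_at t l (iota c * x + y)) =
  c *: tens (subst_at t l x) + tens (subst_at t l y).
Proof.
rewrite leq_eqVlt => /predU1P[->|ltl].
  by rewrite !subst_at_last; apply: (tensP m).1.
by rewrite !(subst_at_ord _ (Ordinal ltl)); apply: (tensP m).2.
Qed.

Lemma gmul_multilinear m (u : gen B m) :
  multilinear (fun t => tens (gmul t u)).
Proof.
apply: multilinear_words => t l c x y lm.
by rewrite !gmul_subst // mulrDl -mulrA tens_subst.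
Qed.

(** Second stage of extending the letterwise product bilinearly: the first factor is already an
    arbitrary tensor, and induction on it reduces the claim to words. *)
Lemma mul_multilinear m (x : V m) :
  multilinear (fun u => lift (gmul_multilinear u) x).
Proof.
apply: multilinear_words => u l c a b lm.
elim/tens_ind: x => [|d t x IHx]; first by rewrite !raddf0 addr0.
rewrite !linearP IHx !lift_tens !(gmulC t) !gmul_subst // mulrDl -mulrA.
by rewrite tens_subst // !scalerDr !scalerA [d * c]mulrC addrACA.
Qed.

Definition tmul m (x y : V m) : V m := lift (mul_multilinear x) y.

Lemma tmul_linearr m (x : V m) c y y' :
  tmul x (c *: y + y') = c *: tmul x y + tmul x y'.
Proof. exact: linearP. Qed.

Lemma tmul_linearl m (y : V m) c x x' :
  tmul (c *: x + x') y = c *: tmul x y + tmul x' y.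
Proof.
elim/tens_ind: y => [|d t y IHy]; first by rewrite /tmul !raddf0 addr0.
rewrite !tmul_linearr IHy /tmul !lift_tens linearP.
by rewrite !scalerDr !scalerA [d * c]mulrC addrACA.
Qed.

Lemma tmul_tens m (t u : gen B m) : tmul (tens t) (tens u) = tens (gmul t u).
Proof. by rewrite /tmul !lift_tens. Qed.

Lemma tmul0r m (x : V m) : tmul x 0 = 0.
Proof. exact: raddf0. Qed.

Lemma tmul0l m (x : V m) : tmul 0 x = 0.
Proof.
by have := tmul_linearl x (-1) 0 0; rewrite scaler0 addr0 scaleN1r addNr.
Qed.

Lemma tmulC m : commutative (@tmul m).
Proof.
move=> x y; elim/tens_ind: x => [|c t x IHx]; first by rewrite tmul0l tmul0r.
rewrite tmul_linearl tmul_linearr IHx; congr (_ *: _ + _).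
elim/tens_ind: y {IHx} => [|d u y IHy]; first by rewrite tmul0l tmul0r.
by rewrite tmul_linearl tmul_linearr IHy !tmul_tens gmulC.
Qed.

Lemma tmulA m : associative (@tmul m).
Proof.
move=> x y z; elim/tens_ind: x => [|c t x IHx]; first by rewrite !tmul0l.
rewrite !tmul_linearl IHx; congr (_ *: _ + _).
elim/tens_ind: y {IHx} => [|d u y IHy]; first by rewrite tmul0l tmul0r tmul0l.
rewrite tmul_linearl !tmul_linearr tmul_linearl IHy; congr (_ *: _ + _).
elim/tens_ind: z {IHy} => [|f v z IHz]; first by rewrite !tmul0r.
by rewrite !tmul_linearr IHz !tmul_tens gmulA.
Qed.

Lemma tmul1 m : left_id (tens (gone m)) (@tmul m).
Proof.
move=> x; elim/tens_ind: x => [|c t x IHx]; first exact: tmul0r.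
by rewrite tmul_linearr IHx tmul_tens gmul1.
Qed.

Lemma tmulDl m : left_distributive (@tmul m) +%R.
Proof. by move=> x y z; have := tmul_linearl z 1 x y; rewrite !scale1r. Qed.

Definition tring m : Type := V m.
HB.instance Definition _ m := GRing.Lmodule.on (tring m).
HB.instance Definition _ m := GRing.Zmodule_isComPzRing.Build (tring m)
  (@tmulA m) (@tmulC m) (@tmul1 m) (@tmulDl m).

Lemma tring_scalerAl m (c : 'F_p) (x y : tring m) : c *: x * y = c *: (x * y).
Proof. by have := tmul_linearl y c x 0; rewrite tmul0l !addr0. Qed.

(** The structure morphism from ['F_p], through which [exprDpX] applies to [tring m]. *)
Definition tscalar m (c : 'F_p) : tring m := c *: (1 : tring m).

Lemma tscalar_zmod m : zmod_morphism (@tscalar m).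
Proof. by move=> c d; apply: scalerBl. Qed.

Lemma tscalar_monoid m : monoid_morphism (@tscalar m).
Proof.
split=> [|c d]; first exact: scale1r.
by rewrite /tscalar tring_scalerAl mul1r scalerA.
Qed.

HB.instance Definition _ m :=
  GRing.isZmodMorphism.Build 'F_p (tring m) (@tscalar m) (@tscalar_zmod m).
HB.instance Definition _ m :=
  GRing.isMonoidMorphism.Build 'F_p (tring m) (@tscalar m) (@tscalar_monoid m).

Lemma tens_exp m (t : gen B m) s :
  (tens t : tring m) ^+ s = tens (mkgen m (fun l => word t l ^+ s)).
Proof.
elim: s => [|s IHs]; first by rewrite expr0.
rewrite exprS IHs [LHS]tmul_tens; congr tens.
by apply: word_inj => l lm; rewrite !word_mkgen // exprS.
Qed.

(** The [q]-th power map is additive in characteristic [p], and [c ^+ q = c] in ['F_p]. *)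
Lemma tring_frobenius m c (x y : tring m) :
  (c *: x + y : tring m) ^+ q = c *: (x ^+ q) + y ^+ q.
Proof.
have scalE (z : tring m) : c *: z = tscalar m c * z.
  by rewrite /tscalar tring_scalerAl mul1r.
rewrite (exprDpX pr_p (@tscalar m)) !scalE exprMn -rmorphXn.
by rewrite (Fp_expX pr_p).
Qed.

Lemma lin_ext m (W : lmodType 'F_p) (f g : {linear V m -> W}) :
  (forall t, f (tens t) = g (tens t)) -> f =1 g.
Proof.
move=> fg x; elim/tens_ind: x => [|c t x IHx]; first by rewrite !raddf0.
by rewrite !linearP IHx fg.
Qed.

(** * Degeneracies, rotation and faces as linear maps *)

Lemma gdeg_multilinear m (j : 'I_m.+2) :
  multilinear (fun t : gen B m => tens (gdeg j t)).
Proof.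
have jm : (j <= m.+1)%N by have := ltn_ord j; lia.
apply: multilinear_words => t l c x y lm.
by rewrite !gdeg_subst // tens_subst //; case: ifP; lia.
Qed.

Definition deg m j : {linear V m -> V m.+1} :=
  lift (gdeg_multilinear (inord j)).

Lemma deg_tens m j (t : gen B m) : (j <= m.+1)%N ->
  deg m j (tens t) = tens (gdeg j t).
Proof. by move=> jm; rewrite lift_tens inordK. Qed.

(** Raising one letter to the power [q] stays linear in that letter, as this power is additive on
    [A] and fixes the scalars. *)
Lemma grot_multilinear m : multilinear (fun t : gen B m => tens (grot t)).
Proof.
apply: multilinear_words => t l c x y lm.
rewrite !grot_subst //; case: ifP => [|l0]; last by rewrite tens_subst //; lia.
by rewrite (exprDpX pr_p iota) exprMn -rmorphXn (Fp_expX pr_p) tens_subst.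
Qed.

Definition rot m : {linear V m -> V m} := lift (@grot_multilinear m).

Lemma rot_tens m (t : gen B m) : rot m (tens t) = tens (grot t).
Proof. exact: lift_tens. Qed.

(** Both sides are linear over ['F_p], and on a word [m.+1] rotations raise each letter to the power
    [q]. *)
Lemma iter_rot m (x : tring m) : iter m.+1 (rot m) x = x ^+ q.
Proof.
have q0 : (0 < q)%N by rewrite expn_gt0 prime_gt0.
have iterP k c (y z : V m) : iter k (rot m) (c *: y + z) =
    c *: iter k (rot m) y + iter k (rot m) z.
  by elim: k => //= k ->; rewrite linearP.
have iter_tens k t : iter k (rot m) (tens t) = tens (iter k (@grot m) t).
  by elim: k => //= k ->; rewrite rot_tens.
elim/tens_ind: x => [|c t x IHx].
  (* The zeroth power of 0 would be 1, so [q] must be nonzero here. *)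
  rewrite expr0n (_ : q == 0%N = false); last by lia.
  by elim: m.+1 => // k /= ->; rewrite raddf0.
by rewrite iterP tring_frobenius IHx iter_tens iter_grot_full tens_exp.
Qed.

Lemma D_D m i j (x : V m.+2) : (i < j <= m.+2)%N ->
  D m i (D m.+1 j x) = D m j.-1 (D m.+1 i x).
Proof.
move=> ijm; apply: (lin_ext (f := D m i \o D m.+1 j)
  (g := D m j.-1 \o D m.+1 i)) => t /=.
by rewrite !D_tens ?(face_face (i := i) (j := j)) //; lia.
Qed.

Lemma D_mul m i (x y : V m.+1) : (i <= m.+1)%N ->
  D m i (tmul x y) = tmul (D m i x) (D m i y).
Proof.
move=> im; elim/tens_ind: x => [|c t x IHx]; first by rewrite !(tmul0l, raddf0).
rewrite tmul_linearl !linearP tmul_linearl IHx; congr (_ *: _ + _).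
elim/tens_ind: y {IHx} => [|d u y IHy]; first by rewrite !(tmul0r, raddf0).
rewrite tmul_linearr !linearP tmul_linearr IHy; congr (_ *: _ + _).
by rewrite tmul_tens !D_tens // tmul_tens face_gmul.
Qed.

Lemma D_deg_lt m i j (x : V m.+1) :
  (i < j <= m.+2)%N -> (0 < i)%N || (j <= m.+1)%N ->
  D m.+1 i (deg m.+1 j x) = deg m j.-1 (D m i x).
Proof.
move=> ijm ij; apply: (lin_ext (f := D m.+1 i \o deg m.+1 j)
  (g := deg m j.-1 \o D m i)) => t /=.
rewrite deg_tens ?D_tens ?deg_tens ?face_gdeg_lt //; lia.
Qed.

Lemma D_deg_eq m j (x : V m) : (j <= m.+1)%N -> D m j (deg m j x) = x.
Proof.
move=> jm; apply: (lin_ext (f := D m j \o deg m j) (g := idfun)) => t /=.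
by rewrite deg_tens // D_tens // face_gdeg_eq.
Qed.

Lemma D_deg_eqS m j (x : V m) : (j <= m)%N -> D m j.+1 (deg m j x) = x.
Proof.
move=> jm; apply: (lin_ext (f := D m j.+1 \o deg m j) (g := idfun)) => t /=.
by rewrite deg_tens 1?leqW // D_tens // face_gdeg_eqS.
Qed.

Lemma D_deg_gt m i j (x : V m.+1) : (j.+1 < i <= m.+2)%N ->
  D m.+1 i (deg m.+1 j x) = deg m j (D m i.-1 x).
Proof.
move=> ijm; apply: (lin_ext (f := D m.+1 i \o deg m.+1 j)
  (g := deg m j \o D m i.-1)) => t /=.
rewrite deg_tens ?D_tens ?deg_tens ?face_gdeg_gt //; lia.
Qed.

Lemma D0_deg_last m (x : V m) : D m 0 (deg m m.+1 x) = rot m x.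
Proof.
apply: (lin_ext (f := D m 0 \o deg m m.+1) (g := rot m)) => t /=.
by rewrite deg_tens // D_tens // rot_tens face0_gdeg_last.
Qed.

Lemma D_rot m i (x : V m.+1) : (i <= m)%N ->
  D m i (rot m.+1 x) = rot m (D m i.+1 x).
Proof.
move=> im; apply: (lin_ext (f := D m i \o rot m.+1)
  (g := rot m \o D m i.+1)) => t /=.
by rewrite rot_tens !D_tens ?rot_tens ?face_grot //; lia.
Qed.

Lemma D_rot_last m (x : V m.+1) : D m m.+1 (rot m.+1 x) = D m 0 x.
Proof.
apply: (lin_ext (f := D m m.+1 \o rot m.+1) (g := D m 0)) => t /=.
by rewrite rot_tens !D_tens // face_grot_last.
Qed.

(** * Boundaries and normalised chains *)

Definition bd m (x : V m.+1) : V m := \sum_(i < m.+2) (-1) ^+ i *: D m i x.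

Lemma bd_linear m : linear (@bd m).
Proof.
move=> c x y; rewrite /bd scaler_sumr -big_split; apply: eq_bigr => i _.
by rewrite linearP scalerDr !scalerA mulrC.
Qed.

HB.instance Definition _ m := GRing.isLinear.Build 'F_p (V m.+1) (V m) *:%R
  (@bd m) (@bd_linear m).

Definition bounds m (x : V m) : Prop := exists y, x = bd y.

Lemma bounds_lin m c (x y : V m) :
  bounds x -> bounds y -> bounds (c *: x + y).
Proof.
by move=> [x' ->] [y' ->]; exists (c *: x' + y'); rewrite linearP.
Qed.

Lemma bounds0 m : bounds (0 : V m).
Proof. by exists 0; rewrite raddf0. Qed.

Lemma boundsD m (x y : V m) : bounds x -> bounds y -> bounds (x + y).
Proof. by rewrite -{2}[x]scale1r; apply: bounds_lin. Qed.

Definition normal m (x : V m.+1) : Prop :=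
  forall i, (i <= m.+1)%N -> D m i x = 0.

(** With s_j the [j]-th degeneracy, s_j is almost a contracting homotopy: in bd (s_j x) + s_j (bd x)
    everything cancels except the term of face [j] of [x]. *)
Lemma bd_deg m j (x : V m.+1) : (j <= m)%N -> bd x = 0 ->
  (forall i, (i < j)%N -> D m i x = 0) ->
  bd (deg m.+1 j x) = (-1) ^+ j *: deg m j (D m j x).
Proof.
move=> jm bx0 Dx0.
have E : bd (deg m.+1 j x) + deg m j (bd x) = (-1) ^+ j *: deg m j (D m j x).
  rewrite /bd linear_sum /=.
  rewrite -(big_mkord xpredT (fun i => (-1) ^+ i *: D m.+1 i (deg m.+1 j x))).
  rewrite -(big_mkord xpredT (fun i => deg m j ((-1) ^+ i *: D m i x))).
  rewrite (big_cat_nat (n := j)) //=; last lia.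
  rewrite (big_cat_nat (n := j) (p := m.+2)) //=; last lia.
  rewrite big1_seq ?add0r => [|i]; last first.
    rewrite mem_index_iota => /andP[_ ij].
    by rewrite D_deg_lt ?Dx0 ?raddf0 //; lia.
  rewrite [X in _ + (X + _)]big1_seq ?add0r => [|i]; last first.
    by rewrite mem_index_iota => /andP[_ ij]; rewrite Dx0 ?raddf0.
  rewrite big_ltn; last lia.
  rewrite big_ltn; last lia.
  rewrite [X in _ + X]big_ltn; last lia.
  have jm1 : (j <= m.+1)%N by lia.
  rewrite D_deg_eq ?D_deg_eqS // ?(leqW jm1) // addrA exprS mulN1r scaleNr.
  (* Faces [j] and [j.+1] of s_j x both equal [x] and have opposite signs. After an index shift,
     face [i.+1] of s_j x cancels face [i] of [x] for [i > j]. *)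
  rewrite subrr add0r big_add1 /= addrCA -big_split big1_seq ?addr0 /=.
    by rewrite linearZ.
  move=> i; rewrite mem_index_iota => /andP[ji im].
  by rewrite D_deg_gt /= ?linearZ ?exprS ?mulN1r ?scaleNr ?addNr //; lia.
by move: E; rewrite bx0 raddf0 addr0.
Qed.

Hypothesis bd_bd : forall m (x : V m.+2), bd (bd x) = 0.

(** Face [i] moves past s_j and then past face [j] until it meets [x]. Hence correcting face [j]
    leaves the lower faces zero. *)
Lemma D_deg_D m i j (x : V m.+1) : (i < j <= m)%N -> D m i x = 0 ->
  D m i (deg m j (D m j x)) = 0.
Proof.
case: m x => [|m] x ijm Dx0; first lia.
rewrite D_deg_lt; [|lia|lia].
by rewrite D_D ?Dx0 ?raddf0 //; lia.
Qed.

(** Faces [0] to [m] are killed in increasing order, each time by subtracting a boundary. The last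
    face then vanishes because the result is still a cycle. *)
Lemma normalize m (x : V m.+1) : bd x = 0 ->
  exists x', normal x' /\ bounds (x - x').
Proof.
move=> bx0.
have step j : (j <= m.+1)%N -> exists x' : V m.+1,
    [/\ bd x' = 0, forall i, (i < j)%N -> D m i x' = 0 & bounds (x - x')].
  elim: j => [|j IHj] jm.
    by exists x; split=> //; rewrite subrr; apply: bounds0.
  have {IHj}[x' [bx' Dx' [y xx']]] := IHj (ltnW jm).
  (* The sign cancels the one in [bd_deg], so face [j] of [bd z] is exactly face [j] of [x']. *)
  pose z := (-1) ^+ j *: deg m.+1 j x'.
  have bz : bd z = deg m j (D m j x').
    by rewrite linearZ /= bd_deg // scalerA -expr2 sqrr_sign scale1r.
  exists (x' - bd z); split; last 1 first.
  - by exists (y + z); rewrite opprB addrCA xx' raddfD addrC.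
  - by rewrite raddfB /= bx' bd_bd subrr.
  move=> i; rewrite ltnS leq_eqVlt => /predU1P[->|ij].
    by rewrite raddfB /= bz D_deg_eq ?subrr // ltnW.
  rewrite raddfB /= bz (Dx' _ ij) D_deg_D ?subrr ?Dx' //; lia.
have [x' [bx' Dx' bxx']] := step _ (leqnn _).
exists x'; split=> // i; rewrite leq_eqVlt => /predU1P[->|]; last exact: Dx'.
(* Only the last face can still contribute to [bd x' = 0]. *)
move: bx'; rewrite /bd big_ord_recr /= big1 ?add0r => [/eqP|i' _].
  by rewrite scaler_eq0 signr_eq0 => /eqP.
by rewrite Dx' ?scaler0.
Qed.

(** Face 0 of the product of degeneracies dies through [y] and faces from 2 on through [x]. Face 1
    gives the product of [x] and [y] with sign -1, whence the minus sign of the witness. *)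
Lemma normal_mul m (x y : V m.+1) : normal x -> normal y -> bounds (tmul x y).
Proof.
move=> nx ny; exists (- tmul (deg m.+1 0 x) (deg m.+1 1 y)).
rewrite raddfN /= /bd 2!big_ord_recl big1 => [|i _].
  rewrite !D_mul //= /bump /= addn0 (D_deg_lt (j := 1)) // ny // raddf0 tmul0r.
  by rewrite D_deg_eqS // D_deg_eq // expr1 scaler0 add0r addr0 scaleN1r opprK.
have im := ltn_ord i; rewrite /= /bump /= !add1n D_mul //.
by rewrite D_deg_gt // nx // raddf0 tmul0l scaler0.
Qed.

Lemma normal_rot m (x : V m.+1) : normal x -> normal (rot m.+1 x).
Proof.
move=> nx i; rewrite leq_eqVlt => /predU1P[->|im].
  by rewrite D_rot_last nx.
by rewrite D_rot // nx ?raddf0.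
Qed.

(** The extra degeneracy of [x] has face 0 equal to the rotation, last face [x] with sign
    (-1)^(m+2), and zero faces in between. *)
Lemma normal_rot_bounds m (x : V m.+1) : normal x ->
  bounds (rot m.+1 x + (-1) ^+ m *: x).
Proof.
move=> nx; exists (deg m.+1 m.+2 x).
rewrite /bd big_ord_recl big_ord_recr /= big1 ?add0r => [|i _].
  by rewrite D0_deg_last D_deg_eq // scale1r !exprS !mulN1r opprK.
have im := ltn_ord i; rewrite /= /bump /= add1n.
by rewrite D_deg_lt ?nx ?raddf0 //; lia.
Qed.

(** Modulo boundaries each rotation is multiplication by (-1)^(m+1); normality persists, so the
    signs multiply. *)
Lemma normal_iter_rot m (x : V m.+1) k : normal x ->
  normal (iter k (rot m.+1) x) /\
  bounds (iter k (rot m.+1) x - (-1) ^+ (m.+1 * k) *: x).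
Proof.
move=> nx; elim: k => [|k [nk bk]].
  by rewrite muln0 scale1r subrr; split=> //; apply: bounds0.
split; first exact: normal_rot.
have := bounds_lin ((-1) ^+ m.+1) bk (normal_rot_bounds nk).
rewrite /=; set y := iter k _ x.
have -> : (-1) ^+ m.+1 *: (y - (-1) ^+ (m.+1 * k) *: x) =
    - ((-1) ^+ m *: y) - (-1) ^+ (m.+1 * k.+1) *: x.
  by rewrite scalerBr scalerA -exprD -mulnS exprS mulN1r scaleNr.
by rewrite addrC -addrA addNKr.
Qed.

Hypothesis e_gt0 : (0 < e)%N.

Lemma normal_exp m (x : tring m.+1) : normal x -> bounds (x ^+ q).
Proof.
move=> nx; have q1 : (1 < q)%N.
  apply: leq_trans (prime_gt1 pr_p) _; rewrite -{1}[p]expn1.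
  exact: leq_pexp2l (prime_gt0 pr_p) e_gt0.
(* Splitting off two factors leaves [x] times [x ^+ q.-1], and the second factor still contains [x],
   hence is normal. *)
have -> : q = q.-2.+2 by lia.
rewrite 2!exprS; apply: normal_mul => // i im; rewrite D_mul // nx //.
exact: tmul0l.
Qed.

(** For a normal representative, [m.+2] rotations give its [q]-th power. This is homologous to the
    representative and is also a boundary. *)
Lemma bd_exact m (x : V m.+1) : bd x = 0 -> bounds x.
Proof.
move=> /normalize[x' [nx' bxx']]; rewrite -[x](subrK x'); apply: boundsD => //.
have [_] := normal_iter_rot m.+2 nx'.
(* The sign is +1 since (m+1)(m+2) is even. *)
rewrite iter_rot -signr_odd oddM /= andbN scale1r => bF.
have := bounds_lin (-1) bF (normal_exp nx').
by rewrite scaleN1r opprB subrK.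
Qed.
End TensorPowers.

(** * Exactness of the Hochschild complex in positive degree *)

Lemma hoch_exact m (x : hoch B m.+1) : (0 < e)%N -> boundary x = 0 ->
  exists y, x = boundary y.
Proof.
move=> e_gt0.
pose V m : lmodType 'F_p := hoch B m.
(* [inord] extends the face maps to all natural indices; only [i <= m.+1] matters. *)
pose D m i : {linear V m.+1 -> V m} := tlift (face_map B (inord i)).
have boundaryE k (y : V k.+1) : boundary y = bd D y.
  by apply: eq_bigr => i _; rewrite /D inord_val.
have D_pure k i (t : gen B k.+1) : (i <= k.+1)%N ->
    D k i (pure t) = pure (face i t).
  by move=> ik; apply: etrans (tlift_pure _ _) _; rewrite /= inordK.
have bd_bd k (y : V k.+2) : bd D (bd D y) = 0.
  by rewrite -!boundaryE boundary_boundary.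
rewrite boundaryE => bx0.
have [y ->] := bd_exact (@pure_multilinear _ _ B) (@hoch_ind _ _ B)
  (fun k k' f fP => @tlift_pure _ _ _ _ _ (Multimap fP)) D_pure bd_bd e_gt0 bx0.
by exists y; rewrite boundaryE.
Qed.

(** * Degree zero: chains modulo boundaries against [psi] *)

Local Notation Psi := (psi p A e).

(* psi as a module over F_p, by restriction of scalars along iota. *)
Definition psiF : Type := Psi.
HB.instance Definition _ := GRing.Zmodule.on psiF.

Definition psiF_scale (c : 'F_p) (x : psiF) : psiF := iota c *: (x : Psi).

Lemma psiF_scaleA a b v : psiF_scale a (psiF_scale b v) = psiF_scale (a * b) v.
Proof. by rewrite /psiF_scale scalerA rmorphM. Qed.

Lemma psiF_scale1 : left_id 1 psiF_scale.
Proof. by move=> v; rewrite /psiF_scale rmorph1 scale1r. Qed.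

Lemma psiF_scaleDr : right_distributive psiF_scale +%R.
Proof. by move=> c; apply: scalerDr. Qed.

Lemma psiF_scaleDl v : {morph psiF_scale^~ v : a b / a + b}.
Proof. by move=> a b; rewrite /psiF_scale rmorphD scalerDl. Qed.

HB.instance Definition _ := GRing.Zmodule_isLmodule.Build 'F_p psiF
  psiF_scaleA psiF_scale1 psiF_scaleDr psiF_scaleDl.

Definition psi_pi (a : A) : psiF := idealq_pi _ a.

Lemma psi_piP c x y : psi_pi (iota c * x + y) = c *: psi_pi x + psi_pi y.
Proof.
by rewrite /psi_pi [LHS]raddfD; congr (_ + _); apply: idealq_pi_scale.
Qed.

Lemma psi_pi_multilinear :
  multilinear (fun t : gen B 0 => psi_pi t.1).
Proof. by split=> [c b b' r|b r []//]; apply: psi_piP. Qed.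

Definition hoch0_psi : {linear hoch B 0 -> psiF} :=
  tlift (Multimap psi_pi_multilinear).

(** The function has the empty domain ['I_0], so its value 0 is never read. *)
Definition hoch0_in (a : A) : hoch B 0 := pure ((a, [ffun=> 0]) : gen B 0).

Lemma pure0E (t : gen B 0) : pure t = hoch0_in t.1.
Proof.
by case: t => b r; congr (pure (_, _)); apply/ffunP => -[].
Qed.

Lemma hoch0_inP c x y :
  hoch0_in (iota c * x + y) = c *: hoch0_in x + hoch0_in y.
Proof. exact: (pure_multilinear B 0).1. Qed.

Lemma hoch0_psi_in a : hoch0_psi (hoch0_in a) = psi_pi a.
Proof. exact: tlift_pure. Qed.

Lemma hoch0_in_surj (x : hoch B 0) : exists a, x = hoch0_in a.
Proof.
elim/hoch_ind: x => [|c t _ [a ->]].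
  exists 0; have := hoch0_inP (-1) 0 0.
  by rewrite mulr0 addr0 scaleN1r addNr.
by exists (iota c * t.1 + a); rewrite hoch0_inP pure0E.
Qed.

Lemma hoch0_inB x y : hoch0_in (x - y) = hoch0_in x - hoch0_in y.
Proof.
have := hoch0_inP (-1) y x; rewrite rmorphN1 mulN1r scaleN1r addrC => ->.
exact: addrC.
Qed.

Lemma boundary_gen1 (t : gen B 1) :
  boundary (pure t) = hoch0_in (t.2 ord0 ^+ q * t.1 - t.2 ord0 * t.1).
Proof.
rewrite boundary_pure big_ord_recl big_ord1 scale1r expr1 scaleN1r !pure0E.
by rewrite hoch0_inB; congr (_ - hoch0_in (t.2 _ * t.1)); apply: val_inj.
Qed.

Lemma psi_pi_eq x y : psi_pi x = psi_pi y <->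
  Defs.span (fun u : A^o => exists a : A, u = a - a ^+ q) (x - y).
Proof. exact: modq_piP. Qed.

Lemma psi_pi_gen (a b : A) : psi_pi (a ^+ q * b - a * b) = 0.
Proof.
have -> : 0 = psi_pi 0 by rewrite /psi_pi [RHS]raddf0.
apply/psi_pi_eq; rewrite subr0 -mulrBl mulrC -opprB mulrN -mulNr.
by apply: (@spanZ _ A^o); apply: span_gen; exists a.
Qed.

Lemma hoch0_psi_boundary (y : hoch B 1) : hoch0_psi (boundary y) = 0.
Proof.
pose f : {linear hoch B 1 -> psiF} := hoch0_psi \o @boundary _ _ B 0.
pose g : {linear hoch B 1 -> psiF} := \0.
apply: (hoch_ext (f := f) (g := g)) => t; rewrite /f /g /=.
by rewrite boundary_gen1 hoch0_psi_in; apply: psi_pi_gen.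
Qed.

(** Each generator [c * (a - a ^+ q)] of the ideal is minus the boundary of (c; a). *)
Lemma hoch0_in_span x :
  Defs.span (fun u : A^o => exists a : A, u = a - a ^+ q) x ->
  exists y, hoch0_in x = boundary y.
Proof.
elim=> [|c u v [a ->] _ [y yv]].
  by exists 0; rewrite -[0]subr0 hoch0_inB subrr raddf0.
exists (y - pure ((c, [ffun=> a]) : gen B 1)).
have -> : boundary (y - pure ((c, [ffun=> a]) : gen B 1)) =
    boundary y - boundary (pure ((c, [ffun=> a]) : gen B 1)).
  exact: raddfB.
rewrite boundary_gen1 -yv -hoch0_inB /= ffunE; congr hoch0_in.
by rewrite opprB addrC -mulrBl mulrC.
Qed.

(** * Homology classes *)

Lemma HH_eq m (z z' : Defs.cycle B m) :
  modq_pi (@is_boundary _ _ B m) z = modq_pi _ z' <->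
  exists y, val z - val z' = boundary y.
Proof.
split=> [/modq_piP /is_boundary_span[y zy]|[y zy]].
  by exists y; rewrite -zy.
by apply/modq_piP/span_gen; exists y; rewrite -zy.
Qed.

Lemma HH_eq0 m (x : HH B m.+1) : (0 < e)%N -> x = 0.
Proof.
move=> e_gt0; rewrite -[x]modq_reprK -[0]modq_reprK; apply/HH_eq.
apply: hoch_exact => //; set z := modq_repr x; set z' := modq_repr 0.
have bz (w : Defs.cycle B m.+1) : boundary (val w) = 0 by exact: (eqP (valP w)).
transitivity (boundary (val z) - boundary (val z')); first exact: raddfB.
by rewrite !bz subrr.
Qed.

(** The differential out of degree 0 is zero by definition, so [eqxx 0] proves the cycle
    condition. *)
Definition hoch0_cycle (a : A) : Defs.cycle B 0 :=
  exist _ (hoch0_in a) (eqxx 0).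

Definition HH0_in (a : A) : HH B 0 :=
  modq_pi (@is_boundary _ _ B 0) (hoch0_cycle a).

Lemma HH0_in_surj (x : HH B 0) : exists a, x = HH0_in a.
Proof.
have [a xa] := hoch0_in_surj (val (modq_repr x)).
exists a; rewrite -[x]modq_reprK; apply/HH_eq.
by exists 0; rewrite xa subrr raddf0.
Qed.

(** One direction holds because [hoch0_psi] kills boundaries, the other because the relations of
    [psi] are boundaries. *)
Lemma HH0_inP a b : HH0_in a = HH0_in b <-> psi_pi a = psi_pi b.
Proof.
split=> [/HH_eq[y /= ab]|/psi_pi_eq/hoch0_in_span[y ab]]; last first.
  by apply/HH_eq; exists y; rewrite -ab -hoch0_inB.
apply/eqP; rewrite -subr_eq0 -!hoch0_psi_in; apply/eqP.
transitivity (hoch0_psi (hoch0_in a - hoch0_in b)).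
  by apply/esym/(raddfB hoch0_psi).
by rewrite ab hoch0_psi_boundary.
Qed.

(** The representative chosen for the class of [a] may differ from [a], but only by a boundary, so
    its image in [psi] is the same. *)
Lemma HH0_repr a : hoch0_psi (val (modq_repr (HH0_in a))) = psi_pi a.
Proof.
have [b ab] := hoch0_in_surj (val (modq_repr (HH0_in a))).
rewrite ab hoch0_psi_in; apply/HH0_inP; apply: etrans (modq_reprK _).
by apply/HH_eq; exists 0; rewrite raddf0 ab subrr.
Qed.

Lemma HH0_inD a b : HH0_in (a + b) = HH0_in a + HH0_in b.
Proof.
have -> : HH0_in a + HH0_in b = modq_pi _ (hoch0_cycle a + hoch0_cycle b).
  exact/esym/raddfD.
apply/HH_eq; exists 0; rewrite raddf0 /=.
have := hoch0_inP 1 a b; rewrite rmorph1 mul1r scale1r => ->.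
exact: subrr.
Qed.

Lemma HH0_in_act a b : HH_act a (HH0_in b) = HH0_in (a * b).
Proof.
rewrite /HH0_in HH_act_pi; apply/HH_eq; exists 0; rewrite raddf0 /=.
by rewrite hoch_act_pure pure0E subrr.
Qed.

End FrobeniusTwist.

Theorem theorem5 (p : nat) (pr_p : prime p) (A : comPzRingType)
    (iota : {rmorphism 'F_p -> A}) (n : nat) (n_gt0 : (0 < n)%N) :
  (forall i : nat, (0 < i)%N ->
     forall x : HH (Phi pr_p iota n A^o) i, x = 0) /\
  (exists f : HH (Phi pr_p iota n A^o) 0 -> psi p A n,
     [/\ bijective f,
         forall x y, f (x + y) = f x + f y &
         forall (a : A) x, f (HH_act a x) = a *: f x]).
Proof.
split=> [[//|i] _ x|]; first exact: HH_eq0.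
pose B := Phi pr_p iota n A^o.
(* Both maps are defined on chosen representatives; [fE] and [gE] give their values on arbitrary
   ones. *)
pose f (x : HH B 0) : psi p A n :=
    hoch0_psi pr_p iota n (val (modq_repr x)).
pose g (y : psi p A n) : HH B 0 := HH0_in pr_p iota n (modq_repr y).
have fE a : f (HH0_in pr_p iota n a) = idealq_pi _ a.
  exact: HH0_repr.
have gE a : g (idealq_pi _ a) = HH0_in pr_p iota n a.
  by apply/HH0_inP; apply: idealq_reprK.
exists f; split.
- exists g => [x|y]; last by rewrite /g fE idealq_reprK.
  by have [a ->] := HH0_in_surj x; rewrite fE gE.
- move=> x y; have [[a ->] [b ->]] := (HH0_in_surj x, HH0_in_surj y).
  by rewrite -HH0_inD !fE; apply: raddfD.
- move=> a x; have [b ->] := HH0_in_surj x.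
  by rewrite HH0_in_act !fE idealq_pi_scale.
Qed.
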